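(* Let $\mathcal{T} = \langle \mathcal{S},\mathcal{A},p,r,\gamma,\beta,\pi_0\rangle$ be an entropy-regularized task with reward function $r=r(s,a)$, optimal action-value function $Q^*$, optimal state-value function $V^*$ and optimal policy $\pi^*$. Let $q(s'\mid s,a)$ be any transition dynamics on the same state and action sets, and define the reward function $$\bar{r}(s,a) = r(s,a) - \gamma\,\mathbb{E}_{s'\sim q(\cdot\mid s,a)}V^*(s') + \gamma\,\mathbb{E}_{s'\sim p(\cdot\mid s,a)}V^*(s').$$ Then the task $\bar{\mathcal{T}}=\langle \mathcal{S},\mathcal{A},q,\bar{r},\gamma,\beta,\pi_0\rangle$ has the same optimal action-value function as $\mathcal{T}$, i.e. $\bar{Q}^*=Q^*$; hence its optimal state-value function and optimal policy satisfy $\bar{V}^*=V^*$ and $\bar{\pi}^*=\pi^*$.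
   Context: An entropy-regularized task $\langle \mathcal{S},\mathcal{A},p,r,\gamma,\beta,\pi_0\rangle$ consists of discrete (finite or countable) state and action sets $\mathcal{S},\mathcal{A}$, transition dynamics $p(s'\mid s,a)$ (a probability distribution over $s'$ for each $(s,a)$), a bounded reward function $r$ (here a function of $(s,a)$ only), a discount factor $\gamma\in(0,1)$, an inverse temperature $\beta>0$, and a prior policy $\pi_0\colon\mathcal{S}\times\mathcal{A}\to(0,1)$ (for each $s$, $\pi_0(\cdot\mid s)$ is a probability distribution on $\mathcal{A}$). The optimal action-value function $Q^*$ of the task is the (unique) bounded solution of the soft Bellman optimality equation $$Q^*(s,a) = r(s,a) + \mathbb{E}_{s'\sim p(\cdot\mid s,a)}\left[\frac{\gamma}{\beta}\log \mathbb{E}_{a'\sim\pi_0(\cdot\mid s')} e^{\beta Q^*(s',a')}\right].$$ The optimal state-value function is $V^*(s)=\frac{1}{\beta}\log\sum_a\pi_0(a\mid s)e^{\beta Q^*(s,a)}$, and the optimal policy is $\pi^*(a\mid s)=\pi_0(a\mid s)e^{\beta Q^*(s,a)}/\sum_{a'}\pi_0(a'\mid s)e^{\beta Q^*(s,a')}$. *)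

(* Defs.v *)
(* MathComp-Analysis, over an abstract [R : realType]. *)
From mathcomp Require Export all_boot all_order all_algebra.
From mathcomp Require Export all_classical all_reals all_analysis.
Import Order.TTheory GRing.Theory Num.Theory.
Import numFieldNormedType.Exports.

Set Implicit Arguments.
Unset Strict Implicit.
Unset Printing Implicit Defensive.

Local Open Scope classical_set_scope.
Local Open Scope ring_scope.

Section Discrete.
Context {R : realType} {T : countType}.

(* [mu] is a probability mass function on the finite or countable type [T]. *)
Definition is_distr (mu : T -> R) : Prop :=
  (forall x, 0 <= mu x) /\ (\esum_(x in [set: T]) (mu x)%:E = 1)%E.

(* [\esum] is meant for nonnegative families, hence the split into positive and
   negative parts.  Both sums are finite when [mu] is a distribution and [f] is
   bounded, so [fine] never meets an infinite value in that case. *)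
Definition mean (mu f : T -> R) : R :=
  let g := fun x => (mu x * f x)%:E in
  fine (\esum_(x in [set: T]) (g^\+ x)%E - \esum_(x in [set: T]) (g^\- x)%E)%E.

End Discrete.

Record soft_task (R : realType) (S A : countType) := SoftTask {
  trans : S -> A -> S -> R;   (* [trans s a s'] is p(s' | s, a) *)
  reward : S -> A -> R;
  discount : R;
  inv_temp : R;
  prior : S -> A -> R         (* [prior s a] is pi_0(a | s) *)
}.

Section SoftTask.
Context {R : realType} {S A : countType}.
Implicit Types (T : soft_task R S A) (Q : S -> A -> R).

Definition bounded2 (f : S -> A -> R) : Prop :=
  bounded_fun (fun x : S * A => f x.1 x.2).

Definition is_dynamics (p : S -> A -> S -> R) : Prop :=
  forall s a, is_distr (p s a).

Definition is_soft_task T : Prop :=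
  [/\ is_dynamics (trans T),
      bounded2 (reward T),
      0 < discount T < 1,
      0 < inv_temp T &
      forall s, is_distr (prior T s) /\ forall a, 0 < prior T s a < 1].

Definition soft_bellman T Q : Prop :=
  forall s a, Q s a = reward T s a +
    mean (trans T s a) (fun s' => discount T / inv_temp T *
      ln (mean (prior T s') (fun a' => expR (inv_temp T * Q s' a')))).

(* Being the optimal action-value function is a predicate on [Q]; uniqueness of
   the bounded solution is not built into it. *)
Definition is_optimal_Q T Q : Prop := bounded2 Q /\ soft_bellman T Q.

(* The optimal state-value function and the optimal policy of [T] are the
   following two functions at the optimal action-value function of [T]. *)
Definition value_of T Q (s : S) : R :=
  (inv_temp T)^-1 * ln (mean (prior T s) (fun a => expR (inv_temp T * Q s a))).

Definition policy_of T Q (s : S) (a : A) : R :=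
  prior T s a * expR (inv_temp T * Q s a) /
  mean (prior T s) (fun a' => expR (inv_temp T * Q s a')).

Definition shifted_task T (q : S -> A -> S -> R) (V : S -> R) :
    soft_task R S A :=
  {| trans := q;
     reward := fun s a =>
       reward T s a - discount T * mean (q s a) V
                    + discount T * mean (trans T s a) V;
     discount := discount T;
     inv_temp := inv_temp T;
     prior := prior T |}.

End SoftTask.

(* Main.v *)
Require Import Defs.
From mathcomp Require Import lra.

(* In terms of V = value_of T Q, the soft Bellman equation of T reads
   Q = r + gamma E_p[V].  For the shifted task the term -gamma E_q[V*] of the
   reward cancels the expectation under the new dynamics, so Q* still solves it.
   It is the only bounded solution: Q <= Q' + D pointwise implies V <= V' + D
   (log-sum-exp is monotone and commutes with adding constants), so the
   Bellman equation improves the bound D between two solutions to gamma D, and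
   iterating gives Q <= Q'. *)

Import Order.TTheory GRing.Theory Num.Theory.
Import numFieldNormedType.Exports.

Set Implicit Arguments.
Unset Strict Implicit.
Unset Printing Implicit Defensive.

Local Open Scope classical_set_scope.
Local Open Scope ring_scope.

(** * Bounded real-valued functions *)

Section BoundedFun.
Context {R : realType} {T : Type}.
Implicit Types (f g : T -> R) (c : R).

Lemma bounded_funP f :
  bounded_fun f <-> exists M, forall x, `|f x| <= M.
Proof.
split=> [/pinfty_ex_gt0[M _ fM]|[M fM]]; first by exists M => x; exact: fM.
exists M; split=> [|N]; rewrite ?num_real // => /ltW MN x _.
exact: le_trans (fM x) MN.
Qed.

Lemma bounded_fun_add f g : bounded_fun f -> bounded_fun g ->
  bounded_fun (fun x => f x + g x).
Proof.
move=> /bounded_funP[M fM] /bounded_funP[N gN]; apply/bounded_funP.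
by exists (M + N) => x; rewrite (le_trans (ler_normD _ _)) // lerD.
Qed.

Lemma bounded_fun_scale c f : bounded_fun f -> bounded_fun (fun x => c * f x).
Proof.
move=> /bounded_funP[M fM]; apply/bounded_funP.
by exists (`|c| * M) => x; rewrite normrM ler_wpM2l.
Qed.

Lemma bounded_fun_const c : bounded_fun (fun _ : T => c).
Proof. by apply/bounded_funP; exists `|c|. Qed.

End BoundedFun.

(** * Scaling of nonnegative sums in the extended reals *)

Section EsumScaling.
Context {R : realType} {T : choiceType}.
Implicit Types (I : set T) (a : T -> \bar R) (c : R).
Local Open Scope ereal_scope.

Let esumZl_le I a c : (0 <= c)%R -> (forall i, 0 <= a i) ->
  \esum_(i in I) (c%:E * a i) <= c%:E * \esum_(i in I) a i.
Proof.
move=> c0 a0; apply: ge_ereal_sup => _ [X XI <-].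
rewrite -ge0_mule_fsumr //; apply: lee_wpmul2l; first by rewrite lee_fin.
by apply: ereal_sup_ubound; exists X.
Qed.

(** The missing inequality is [esumZl_le] with factor c^-1 applied to the already scaled family, so
    c = 0 is treated apart. *)
Lemma esumZl I a c : (0 <= c)%R -> (forall i, 0 <= a i) ->
  \esum_(i in I) (c%:E * a i) = c%:E * \esum_(i in I) a i.
Proof.
move=> c0 a0; apply/eqP; rewrite eq_le esumZl_le //=.
have [->|cn0] := eqVneq c 0%R.
  by rewrite mul0e esum_ge0 // => i _; rewrite mul0e.
have cV (x : \bar R) : (c^-1)%:E * (c%:E * x) = x.
  by rewrite muleA -EFinM mulVf // mul1e.
have cK (x : \bar R) : c%:E * ((c^-1)%:E * x) = x.
  by rewrite muleA -EFinM mulfV // mul1e.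
rewrite -[leRHS]cK; apply: lee_wpmul2l; first by rewrite lee_fin.
under eq_esum do rewrite -[a _]cV.
by apply: esumZl_le => [|i]; rewrite ?invr_ge0 // mule_ge0 // lee_fin.
Qed.

End EsumScaling.

(** * Expectation of bounded functions under a discrete distribution *)

Section Mean.
Context {R : realType} {T : countType}.
Context (mu : T -> R) (mu_distr : is_distr mu).
Implicit Types (f g : T -> R) (c M : R).

Let F f x := (mu x * f x)%:E.

Let mu0 x : 0 <= mu x. Proof. by case: mu_distr. Qed.

(** If M bounds |f|, the absolute sum is at most M times the total mass 1. *)
Lemma summable_distr f : bounded_fun f -> summable [set: T] (F f).
Proof.
move=> /bounded_funP[M fM].
(* M >= 0 is read off from a value of f, so the empty type is handled separately. *)
have [|x0] := pselect (exists x : T, True); last first.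
  rewrite /summable (_ : [set: T] = set0) ?esum_set0 ?ltry //.
  by rewrite -subset0 => x _; apply: x0; exists x.
move=> [x0 _]; have M0 : 0 <= M := le_trans (normr_ge0 _) (fM x0).
apply: (@le_lt_trans _ _ (M%:E * \esum_(x in [set: T]) (mu x)%:E)%E).
  rewrite -esumZl //; apply: le_esum => x _.
  by rewrite /F /= -EFinM lee_fin normrM ger0_norm // mulrC ler_wpM2r.
by case: mu_distr => _ ->; rewrite mule1 ltry.
Qed.

Let fin_part f : bounded_fun f ->
  ((\esum_(x in [set: T]) (F f)^\+ x)%E \is a fin_num) *
  ((\esum_(x in [set: T]) (F f)^\- x)%E \is a fin_num).
Proof.
move=> /summable_distr sf.
have fin (h : T -> \bar R) : (forall x, 0 <= h x)%E -> summable [set: T] h ->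
    (\esum_(x in [set: T]) h x)%E \is a fin_num.
  move=> h0; rewrite summableE; congr (_ \is a fin_num).
  by apply: eq_esum => x _; rewrite gee0_abs.
by split; apply: fin => //; [exact: summable_funepos|exact: summable_funeneg].
Qed.

(** Removes [fine]: both sums are finite for bounded f, so properties of [mean] can be proved in the
    extended reals and carried back. *)
Let meanE f : bounded_fun f -> (mean mu f)%:E =
  (\esum_(x in [set: T]) (F f)^\+ x - \esum_(x in [set: T]) (F f)^\- x)%E.
Proof. by move=> bf; rewrite /mean fineK // fin_numB !fin_part. Qed.

Lemma le_mean f g : bounded_fun f -> bounded_fun g ->
  (forall x, f x <= g x) -> mean mu f <= mean mu g.
Proof.
move=> bf bg fg; rewrite -lee_fin !meanE //.
have FG x : (F f x <= F g x)%E by rewrite lee_fin ler_wpM2l.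
(* Positive parts grow with the function and negative parts shrink. *)
apply: leeB; apply: le_esum => x _.
- by rewrite !funeposE ge_max !le_max FG lexx /= orbT.
- by rewrite !funenegE ge_max !le_max leeN2 FG lexx /= orbT.
Qed.

Lemma meanD f g : bounded_fun f -> bounded_fun g ->
  mean mu (fun x => f x + g x) = mean mu f + mean mu g.
Proof.
move=> bf bg; apply: EFin_inj; rewrite EFinD !meanE //; last first.
  exact: bounded_fun_add.
have [sf sg] := (summable_distr bf, summable_distr bg).
(* The positive part of a sum is not the sum of the positive parts. But f^+ + g^+ and f^- + g^- are
   nonnegative, summable and differ by f + g, and [esumB] allows any such decomposition. *)
have := @esumB _ _ [set: T] ((F f)^\+ \+ (F g)^\+)%E ((F f)^\- \+ (F g)^\-)%E.
have -> : ((F f)^\+ \+ (F g)^\+ \- ((F f)^\- \+ (F g)^\-))%E =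
          F (fun x => f x + g x).
  apply/funext => x; rewrite funeposE funenegE !funeposE !funenegE /F.
  rewrite -!EFinN -!EFin_max -!EFinD; congr EFin.
  rewrite mulrDr /Num.max; case: ifP; case: ifP; case: ifP; case: ifP; lra.
move=> ->; last 4 first.
- by apply: summableD; exact: summable_funepos.
- by apply: summableD; exact: summable_funeneg.
- by move=> x _; rewrite adde_ge0.
- by move=> x _; rewrite adde_ge0.
rewrite !esumD // addeACA oppeD //.
by rewrite fin_num_adde_defl // fin_part.
Qed.

Lemma meanZ c f : 0 <= c -> bounded_fun f ->
  mean mu (fun x => c * f x) = c * mean mu f.
Proof.
move=> c0 bf; apply: EFin_inj; rewrite EFinM !meanE //; last first.
  exact: bounded_fun_scale.
have FZ : F (fun x => c * f x) = (fun x => c%:E * F f x)%E.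
  by apply/funext => x; rewrite /F mulrCA EFinM.
rewrite FZ ge0_funeposM // ge0_funenegM // !esumZl // muleBr //.
by rewrite fin_num_adde_defl // fin_numN fin_part.
Qed.

(** For c = 1 this is the total mass; scaling extends it to c >= 0. *)
Lemma mean_const c : mean mu (fun=> c) = c.
Proof.
have mean1 : mean mu (fun=> 1) = 1.
  apply: EFin_inj; rewrite meanE; last exact: bounded_fun_const.
  have F0 x : (0 <= F (fun=> 1%R) x)%E by rewrite lee_fin mulr1.
  rewrite [X in (_ - X)%E]esum1 ?sube0; last first.
    by move=> x _; rewrite (@ge0_funenegE _ _ [set: T]) ?inE.
  case: mu_distr => _ <-; apply: eq_esum => x _.
  by rewrite (@ge0_funeposE _ _ [set: T]) ?inE // /F mulr1.
have mean_ge0 d : 0 <= d -> mean mu (fun=> d) = d.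
  move=> d0; rewrite -[RHS]mulr1 -mean1 -meanZ //; last exact: bounded_fun_const.
  by congr mean; apply/funext => x; rewrite mulr1.
have [|c0] := leP 0 c; first exact: mean_ge0.
(* [meanZ] covers only nonnegative factors; a negative c is reached from c + (- c) = 0 by
   additivity. *)
have := meanD (bounded_fun_const c) (bounded_fun_const (- c)).
rewrite subrr (mean_ge0 0) // (mean_ge0 (- c)) ?oppr_ge0 ?ltW //.
by move/eqP; rewrite eq_sym subr_eq0 => /eqP.
Qed.

Lemma mean_bound f M : (forall x, `|f x| <= M) -> `|mean mu f| <= M.
Proof.
move=> fM; have bf : bounded_fun f by apply/bounded_funP; exists M.
have bc := bounded_fun_const.
rewrite ler_norml -[leLHS]mean_const -[X in _ && (_ <= X)]mean_const.
by rewrite !le_mean // => x; have := fM x; rewrite ler_norml => /andP[].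
Qed.

End Mean.

(** * Soft state values of bounded action-value functions *)

Section SoftTaskTheory.
Context {R : realType} {S A : countType}.
Implicit Types (T : soft_task R S A) (Q : S -> A -> R).

Lemma bounded2P (f : S -> A -> R) :
  bounded2 f <-> exists M, forall s a, `|f s a| <= M.
Proof.
rewrite /bounded2 bounded_funP; split=> -[M fM]; exists M; last by move=> [].
by move=> s a; exact: (fM (s, a)).
Qed.

Section Value.
Context (T : soft_task R S A) (T_task : is_soft_task T).

Let beta_gt0 : 0 < inv_temp T. Proof. by case: T_task. Qed.

Let prior_distr s : is_distr (prior T s).
Proof. by case: T_task => _ _ _ _ /(_ s)[]. Qed.

Lemma bounded_fun_exp Q s : bounded2 Q ->
  bounded_fun (fun a => expR (inv_temp T * Q s a)).
Proof.
move=> /bounded2P[M QM]; apply/bounded_funP; exists (expR (inv_temp T * M)) => a.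
rewrite ger0_norm ?expR_ge0 // ler_expR ler_pM2l //.
exact: le_trans (ler_norm _) (QM s a).
Qed.

(** Makes the logarithm in [value_of] meaningful. As [le_mean] is not strict, the exponentials are
    bounded below by a positive constant, obtained from the bound on Q. *)
Lemma mean_exp_gt0 Q s : bounded2 Q ->
  0 < mean (prior T s) (fun a => expR (inv_temp T * Q s a)).
Proof.
move=> bQ; have /bounded2P[M QM] := bQ.
rewrite (@lt_le_trans _ _ (expR (inv_temp T * - M))) ?expR_gt0 //.
rewrite -[leLHS](mean_const (prior_distr s)); apply: le_mean => //.
- exact: bounded_fun_const.
- exact: bounded_fun_exp.
- move=> a; rewrite ler_expR ler_pM2l //.
  by have := QM s a; rewrite ler_norml => /andP[].
Qed.

Lemma le_value_of Q Q' D s : bounded2 Q -> bounded2 Q' ->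
  (forall a, Q s a <= Q' s a + D) -> value_of T Q s <= value_of T Q' s + D.
Proof.
move=> bQ bQ' QD.
(* In this form D enters the logarithm as a factor, then the mean, and finally the exponent, giving
   exp (beta (Q' + D)). *)
have -> : D = (inv_temp T)^-1 * ln (expR (inv_temp T * D)).
  by rewrite expRK mulKf // gt_eqF.
rewrite /value_of -mulrDr ler_pM2l ?invr_gt0 // addrC.
rewrite -lnM ?posrE ?expR_gt0 ?mean_exp_gt0 // ler_ln ?posrE; last 2 first.
- exact: mean_exp_gt0.
- by rewrite mulr_gt0 ?expR_gt0 ?mean_exp_gt0.
rewrite -meanZ ?expR_ge0 //; last exact: bounded_fun_exp.
apply: le_mean => //; first exact: bounded_fun_exp.
  by apply: bounded_fun_scale; exact: bounded_fun_exp.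
by move=> a; rewrite -expRD ler_expR -mulrDr ler_pM2l // addrC.
Qed.

(** Q is compared in both directions with the zero function, whose value is 0; a bound on Q thus
    bounds its value as well. *)
Lemma bounded_value_of Q : bounded2 Q -> bounded_fun (value_of T Q).
Proof.
move=> bQ; have /bounded2P[M QM] := bQ.
have b0 : bounded2 (fun (_ : S) (_ : A) => 0 : R).
  by apply/bounded2P; exists 0 => s a; rewrite normr0.
have v0 s : value_of T (fun _ _ => 0) s = 0.
  by rewrite /value_of mulr0 expR0 mean_const // ln1 mulr0.
apply/bounded_funP; exists M => s; rewrite ler_norml; apply/andP; split.
  rewrite -subr_ge0 opprK -(v0 s); apply: le_value_of => // a.
  by have := QM s a; rewrite ler_norml => /andP[]; lra.
rewrite -[leRHS]add0r -(v0 s); apply: le_value_of => // a.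
by have := QM s a; rewrite ler_norml => /andP[]; lra.
Qed.

(** * The soft Bellman equation and uniqueness of its bounded solution *)

Lemma soft_bellmanE Q : bounded2 Q ->
  soft_bellman T Q <-> forall s a,
    Q s a = reward T s a + discount T * mean (trans T s a) (value_of T Q).
Proof.
move=> bQ; case: T_task => pT _ /andP[g0 _] _ _.
have bV := bounded_value_of bQ.
suff E s a : discount T * mean (trans T s a) (value_of T Q) =
    mean (trans T s a) (fun s' => discount T / inv_temp T *
      ln (mean (prior T s') (fun a' => expR (inv_temp T * Q s' a')))).
  by split=> H s a; rewrite H E.
(* Inside the mean, gamma meets the beta^-1 of [value_of] and forms gamma / beta. *)
rewrite -meanZ ?ltW //; congr mean; apply/funext => s'.
by rewrite /value_of mulrA.
Qed.

(** The one-sided bound D replaces a sup-norm distance: it passes through [value_of] and [mean]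
    unchanged and is then multiplied by gamma. *)
Lemma optimal_Q_contraction Q Q' D : is_optimal_Q T Q -> is_optimal_Q T Q' ->
  (forall s a, Q s a <= Q' s a + D) ->
  forall s a, Q s a <= Q' s a + discount T * D.
Proof.
move=> [bQ] /soft_bellmanE-/(_ bQ) QE [bQ'] /soft_bellmanE-/(_ bQ') Q'E QD s a.
case: T_task => /(_ s a) ps _ /andP[g0 _] _ _.
have [bV bV'] := (bounded_value_of bQ, bounded_value_of bQ').
rewrite QE Q'E -addrA lerD2l -mulrDr ler_pM2l //.
rewrite -[X in _ + X](mean_const ps) -meanD //; last exact: bounded_fun_const.
apply: le_mean => //.
  by apply: bounded_fun_add => //; exact: bounded_fun_const.
by move=> s'; exact: le_value_of.
Qed.

Lemma optimal_Q_le Q Q' : is_optimal_Q T Q -> is_optimal_Q T Q' ->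
  forall s a, Q s a <= Q' s a.
Proof.
move=> oQ oQ' s a.
have [[/bounded2P[M QM] _] [/bounded2P[N QN] _]] := (oQ, oQ').
(* The initial gap M + N comes from Q <= M and - N <= Q'. *)
have iter n s' a' : Q s' a' <= Q' s' a' + discount T ^+ n * (M + N).
  elim: n s' a' => [s' a'|n IH s' a'].
    have := QM s' a'; have := QN s' a'; rewrite expr0 !ler_norml.
    by move=> /andP[? _] /andP[_ ?]; lra.
  by rewrite exprS -mulrA; exact: optimal_Q_contraction IH s' a'.
have g1 : `|discount T| < 1.
  by case: T_task => _ _ /andP[g0 g1] _ _; rewrite gtr0_norm.
have lim0 : (fun n => Q' s a + discount T ^+ n * (M + N)) @ \oo --> Q' s a.
  rewrite -[X in _ --> X]addr0 -(mul0r (M + N)).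
  by apply: cvgD; [exact: cvg_cst|apply: cvgMl; exact: cvg_expr].
rewrite -(cvg_lim _ lim0) //; apply: limr_ge.
  by apply/cvg_ex; eexists; exact: lim0.
by apply: nearW => n.
Qed.

Lemma optimal_Q_unique Q Q' : is_optimal_Q T Q -> is_optimal_Q T Q' -> Q = Q'.
Proof.
move=> oQ oQ'; apply/funext => s; apply/funext => a.
by apply/eqP; rewrite eq_le !optimal_Q_le.
Qed.

End Value.

(** * The task with changed dynamics and compensated reward *)

Lemma is_soft_task_shifted T q V : is_soft_task T -> is_dynamics q ->
  bounded_fun V -> is_soft_task (shifted_task T q V).
Proof.
move=> [pT /bounded2P[M rM] g b pri] dq /bounded_funP[K VK]; split=> //.
(* One summand for [reward T] and one for each of the two expectations of V, which inherit the bound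
   K. *)
apply/bounded2P; exists (M + `|discount T| * K + `|discount T| * K) => s a /=.
rewrite (le_trans (ler_normD _ _)) // lerD //; last first.
  by rewrite normrM ler_wpM2l // mean_bound.
by rewrite (le_trans (ler_normB _ _)) // lerD // normrM ler_wpM2l // mean_bound.
Qed.

End SoftTaskTheory.

Theorem theorem9 (R : realType) (S A : countType) (T : soft_task R S A)
    (Qs : S -> A -> R) (q : S -> A -> S -> R) :
  is_soft_task T -> is_optimal_Q T Qs -> is_dynamics q ->
  let Tbar := shifted_task T q (value_of T Qs) in
  is_soft_task Tbar /\
  is_optimal_Q Tbar Qs /\
  (forall Qbar : S -> A -> R, is_optimal_Q Tbar Qbar ->
     [/\ Qbar = Qs,
         value_of Tbar Qbar = value_of T Qs &
         policy_of Tbar Qbar = policy_of T Qs]).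
Proof.
move=> tT [bQ bellQ] dq Tbar.
have tTbar : is_soft_task Tbar.
  by apply: is_soft_task_shifted => //; exact: bounded_value_of.
have oQ : is_optimal_Q Tbar Qs.
  split=> //; apply/soft_bellmanE => // s a.
  (* [value_of] reads only the inverse temperature and the prior, which both tasks share. *)
  have -> : value_of Tbar Qs = value_of T Qs by [].
  (* The two gamma E_q[V*] terms cancel, leaving the Bellman equation of [T]. *)
  move/soft_bellmanE: bellQ => -> //=; lra.
split=> //; split=> // Qbar oQbar.
(* With [Qbar] replaced by [Qs], the values and the policies agree by conversion. *)
by rewrite (optimal_Q_unique tTbar oQbar oQ).
Qed.
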